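(* (a) Let $t\ge s\ge k\ge 2$. Then \[ st-kt+1\le mc_k(K_{s,t})\le st-\left\lceil\frac{kt}{2}\right\rceil+1. \] Moreover, if $s=k\ge 2$, or if $k\in\{2,3\}$, then $mc_k(K_{s,t})=st-kt+1$. (b) Let $t\ge k\ge 2$. Then \[ t^2-kt+1\le mc_k(K_{t,t})\le t^2-\left\lceil\left(k-\frac{1}{2}\right)t\right\rceil+1. \] Moreover, if $k\in\{2,3,4,5\}$, then $mc_k(K_{t,t})=t^2-kt+1$.
   Context: $K_{s,t}$ is the complete bipartite graph with partition classes of sizes $s$ and $t$. Paths are called disjoint if they are internally vertex-disjoint. An edge-coloured path is monochromatic if all its edges have the same colour. For a $k$-connected graph $G$, an edge-colouring is monochromatic $k$-connected if any two vertices are connected by $k$ disjoint monochromatic paths; $mc_k(G)$ is the maximum number of colours in a monochromatic $k$-connected colouring of $G$. *)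

(* Defs.v *)
From mathcomp Require Import all_boot.
From mathcomp Require Import boolp.
Set Implicit Arguments. Unset Strict Implicit. Unset Printing Implicit Defensive.

(* A finite simple graph: vertex finType V with a symmetric irreflexive
   adjacency relation [adj].  Edges are the 2-element vertex sets {u,v}
   with [adj u v]. *)
Section Graph.
Variables (V : finType) (adj : rel V).

Definition edges : {set {set V}} :=
  [set e : {set V} | [exists u, exists v, adj u v && (e == [set u; v])]].

(* An edge-colouring assigns a colour to every 2-set (only values on edges
   matter).  Colours are taken in 'I_#|edges| (no loss of generality: a
   colouring uses at most #|edges| colours and colours can be renamed). *)
Definition colouring := {ffun {set V} -> 'I_#|edges|}.

Variable c : colouring.

Definition is_path (u v : V) (p : seq V) : bool :=
  [&& path adj u p, last u p == v & uniq (u :: p)].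

Definition mono_path (u : V) (p : seq V) : bool :=
  constant [seq c [set xy.1; xy.2] | xy <- zip (u :: p) p].

Definition interior (v : V) (p : seq V) : seq V := [seq x <- p | x != v].

Definition mono_k_connected (k : nat) : Prop :=
  forall u v : V, u != v ->
    exists ps : seq (seq V),
      [/\ size ps = k, uniq ps,
          all (fun p => is_path u v p && mono_path u p) ps &
          pairwise (fun p q => [disjoint interior v p & interior v q]) ps].

End Graph.

Definition num_colours (V : finType) (adj : rel V) (c : colouring adj) : nat :=
  #|[set c e | e in edges adj]|.

(* mc_k(G): the maximum number of colours in a monochromatic k-connected
   edge-colouring of G (0 if none exists). *)
Definition mc (k : nat) (V : finType) (adj : rel V) : nat :=
  \max_(c : colouring adj | `[< mono_k_connected c k >]) num_colours c.

Definition Kbip_adj (s t : nat) : rel ('I_s + 'I_t) :=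
  fun x y => match x, y with
             | inl _, inr _ | inr _, inl _ => true
             | _, _ => false
             end.

(* Main.v *)
(* Write W for the sum over the colours of (number of edges - 1), so that a colouring
   of K_{s,t} uses st - W colours. Splitting colour classes into connected components
   only adds colours, so every class with n edges may be assumed to be connected and to
   meet at most n + 1 vertices.

   Upper bounds. The first (and the last) edges of k disjoint paths are distinct, so any
   two vertices u, v satisfy sum_i min(deg_i u, deg_i v) >= k. Summing over the pairs in T,
   a class with n edges that meets a vertices of T contributes at most n(a - 1), and
   n(a - 1) <= (t - 1)(n - 1) unless a = t, in which case t - 1 more is needed. Hence
   W >= kt - p, where p counts the classes that meet all of T. If s = t, summing over the
   pairs in S as well gives W >= kt - q, where q counts the spanning classes. Many such
   classes are expensive, which gives the general bounds. For small k a counterexample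
   has exactly two such classes, all other edges have private colours, and all the
   inequalities are tight. This forces a class that is a star centred in S (k = 3), or one
   that is a Hamilton cycle (k = 4, 5), whose two u-v paths cover all the vertices and
   leave no room for a path of the other class.

   Lower bound. Give one colour to the edges x j with (x - j mod s) < k and private
   colours to all the others. The k disjoint paths come from two matchings: following
   them alternately from the neighbours of u, the orbits end at the neighbours of v. *)
Require Import Defs.
From mathcomp Require Import all_boot ssralg zmodp zify.
From mathcomp Require Import boolp.
Set Implicit Arguments. Unset Strict Implicit. Unset Printing Implicit Defensive.
Import GRing.Theory.

(** * Double counting *)

(** For [w < M] and [n > 0] the slack [M * (n - 1) - n * w] equals
    [w * (M - 1 - w) + (M - w) * (n - 1 - w)], a sum of nonnegative terms. For [w = M] exactly [M]
    more is needed. *)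
Lemma extremal_ineq (n w M : nat) : w <= M -> w <= n - 1 ->
  n * w <= M * (n - 1) + M * (w == M).
Proof.
move=> wM wn; case: eqP => [->|/eqP nwM]; first by case: n wn => [|n] wn; nia.
have ltwM : w < M by rewrite ltn_neqAle nwM.
case: n wn => [|n] wn; first by nia.
have [e ->] : exists e, M = w + e.+1 by exists (M - w.+1); lia.
have [g ->] : exists g, n = w + g by exists (n - w); lia.
nia.
Qed.

(** Equality makes both terms of the slack above vanish. *)
Lemma extremal_eq (n w M : nat) : 0 < n -> w < M -> w <= n - 1 ->
  M * (n - 1) <= n * w -> n = w.+1 /\ (w == 0) || (w == M.-1).
Proof.
move=> n0 ltwM; case: n n0 => // n _ wn.
have [e ->] : exists e, M = w + e.+1 by exists (M - w.+1); lia.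
have [g ->] : exists g, n = w + g by exists (n - w); lia.
move=> H; have : w * e + g * e.+1 = 0 by nia.
move/eqP; rewrite addn_eq0 !muln_eq0 orbF => /andP[we /eqP g0].
split; first by lia.
by case/orP: we => /eqP->; rewrite ?eqxx // addn1 eqxx orbT.
Qed.

Section ExtremalSum.
Variables (K : finType) (n w : K -> nat) (M P : nat).
Hypotheses (M_gt0 : 0 < M) (wM : forall i, w i <= M) (wn : forall i, w i <= n i - 1).
Hypothesis PM : P * M <= \sum_i n i * w i.

Let term_le i : n i * w i <= M * (n i - 1) + M * (w i == M).
Proof. exact: extremal_ineq. Qed.

Let sum_terms :
  \sum_i (M * (n i - 1) + M * (w i == M)) =
  M * (\sum_i (n i - 1) + #|[set i | w i == M]|).
Proof.
rewrite big_split /= -!big_distrr /= -mulnDr; congr (M * (_ + _)).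
by rewrite -sum1dep_card [RHS]big_mkcond; apply: eq_bigr => i _; case: eqP.
Qed.

(** The termwise inequality is summed and divided by [M]. In the applications [n i] counts edges,
    [w i] counts touched vertices less one per side, and [P] is [k * t]. *)
Lemma extremal_sum : P <= \sum_i (n i - 1) + #|[set i | w i == M]|.
Proof.
rewrite -(leq_pmul2l M_gt0) -sum_terms mulnC; apply: leq_trans PM _.
exact: leq_sum.
Qed.

Lemma extremal_sum_eq i :
  P = \sum_i (n i - 1) + #|[set i | w i == M]| ->
  0 < n i -> w i < M -> n i = (w i).+1 /\ (w i == 0) || (w i == M.-1).
Proof.
move=> eqP ni0 wiM; apply: extremal_eq => //.
move: PM; rewrite eqP mulnC -sum_terms (bigD1 i) //= [X in _ <= X](bigD1 i) //=.
have := leq_sum (index_enum K) (P := predC1 i) (fun j _ => term_le j).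
by rewrite (ltn_eqF wiM) muln0 addn0 /=; lia.
Qed.

End ExtremalSum.

Section PairCount.
Variables (K T : finType) (d : K -> T -> nat) (k : nat).
Hypothesis common : forall y y', y != y' -> k <= \sum_i minn (d i y) (d i y').

(** Sum [common] over ordered pairs. For fixed [i] and [y], a term is at most [d i y] and vanishes
    unless [y'] is one of the other vertices that [i] touches. *)
Lemma pair_count :
  k * #|T| * (#|T| - 1) <=
  \sum_i (\sum_y d i y) * (#|[set y | 0 < d i y]| - 1).
Proof.
apply: (@leq_trans (\sum_(y : T) \sum_(y' | y' != y) \sum_i minn (d i y) (d i y'))).
  have -> : k * #|T| * (#|T| - 1) = #|T| * (k * (#|T| - 1)) by rewrite mulnCA mulnA.
  rewrite -sum_nat_const; apply: leq_sum => y _.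
  apply: (@leq_trans (\sum_(y' | y' != y) k)).
    by rewrite sum_nat_const cardC1 subn1 mulnC.
  by apply: leq_sum => y' ny; apply: common; rewrite eq_sym.
under eq_bigr => y _ do rewrite exchange_big /=.
rewrite exchange_big /=; apply: leq_sum => i _.
rewrite big_distrl /=; apply: leq_sum => y _.
have [->|dy] := posnP (d i y); first by rewrite big1 // => y' _; rewrite min0n.
rewrite (cardsD1 y) inE dy addKn.
rewrite mulnC -sum_nat_const big_mkcond [X in _ <= X]big_mkcond /=.
apply: leq_sum => y' _; rewrite !inE.
by case: eqP => //= _; case: posnP => [->|_]; rewrite ?minn0 ?geq_minl.
Qed.

End PairCount.

(** Each [d1 y + d2 y] is at least [k], so the given total forces equality. Replacing a degree by a
    minimum then loses nothing, hence [d1 y <= d1 y'] for all pairs. *)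
Lemma const_degrees (T : finType) (d1 d2 : T -> nat) (k : nat) :
  1 < #|T| -> \sum_y (d1 y + d2 y) = k * #|T| ->
  (forall y y', y != y' -> k <= minn (d1 y) (d1 y') + minn (d2 y) (d2 y')) ->
  (forall y, d1 y + d2 y = k) /\ (forall y y', d1 y = d1 y').
Proof.
move=> T1 sumd common.
have ge_k y : k <= d1 y + d2 y.
  have [y' ny] : exists y', y' != y.
    have : 0 < #|predC1 y| by rewrite cardC1; lia.
    by case/card_gt0P=> y' /[!inE]; exists y'.
  by have := common y y'; rewrite eq_sym ny => /(_ isT); lia.
have eq_k y : d1 y + d2 y = k.
  apply/eqP; rewrite eqn_leq ge_k andbT.
  have : \sum_y (d1 y + d2 y) = \sum_(y : T) k by rewrite sumd sum_nat_const mulnC.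
  rewrite (bigD1 y) //= [RHS](bigD1 y) //=.
  have : \sum_(i | i != y) k <= \sum_(i | i != y) (d1 i + d2 i) by apply: leq_sum.
  lia.
split=> // y y'; have [->//|ny] := eqVneq y y'.
by have := common _ _ ny; have := eq_k y; have := eq_k y'; lia.
Qed.

(** * Systems of disjoint paths and colour classes *)

(** Paths are stored without their source, which [uniq (u :: p)] keeps off the list, so distinct
    paths may meet only in [v]. Repetitions are excluded by [uniq ps] alone. *)
Definition path_system (V : eqType) (ok : V -> pred (seq V)) (u v : V)
    (ps : seq (seq V)) : Prop :=
  [/\ uniq ps,
      {in ps, forall p : seq V, [/\ ok u p, last u p = v & uniq (u :: p)]} &
      {in ps &, forall p q : seq V, p != q -> forall x, x \in p -> x \in q -> x = v}].

Lemma pairwise_interiorP (V : finType) (v : V) (ps : seq (seq V)) : uniq ps ->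
  reflect {in ps &, forall p q : seq V, p != q -> forall x, x \in p -> x \in q -> x = v}
    (pairwise (fun p q => [disjoint interior v p & interior v q]) ps).
Proof.
(* [pairwise_all2rel] asks for a reflexive relation. Adding equality changes nothing because [ps]
   has no repetitions. *)
pose r p q := (p == q) || [disjoint interior v p & interior v q].
have r_sym : symmetric r by move=> p q; rewrite /r eq_sym disjoint_sym.
have r_refl : reflexive r by move=> p; rewrite /r eqxx.
have intP p q : reflect (forall x, x \in p -> x \in q -> x = v)
    [disjoint interior v p & interior v q].
  rewrite disjoint_has; apply: (iffP hasPn) => [H x xp xq | H x].
    by apply/eqP; apply/negPn/negP => xv; have := H x; rewrite !mem_filter xv xp xq => /(_ isT).
  rewrite !mem_filter => /andP[xv xp]; rewrite xv /=; apply/negP => xq.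
  by rewrite (H x) ?eqxx in xv.
move=> ups.
have -> : pairwise (fun p q => [disjoint interior v p & interior v q]) ps = pairwise r ps.
  elim: ps ups => //= p ps IH /andP[pps ups]; rewrite IH //; congr (_ && _).
  apply: eq_in_all => q qps; rewrite /r; case: eqP => //= pq.
  by rewrite pq qps in pps.
rewrite (pairwise_all2rel r_refl r_sym); apply: (iffP allrelP) => H p q pps qps.
  by move=> pq; apply/intP; have := H p q pps qps; rewrite /r (negPf pq).
by rewrite /r; case: (eqVneq p q) => //= pq; apply/intP; apply: H.
Qed.

Section PathSystem.
Variables (V : eqType) (ok : V -> pred (seq V)) (u v : V) (ps : seq (seq V)).
Hypotheses (uv : u != v) (sys : path_system ok u v ps).

(** Two distinct paths share only endpoints, and [g] selects an endpoint only on the single-edge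
    path, which occurs once. *)
Lemma path_system_inj (g : seq V -> V) :
  {in ps, forall p, g p \in u :: p} ->
  {in ps, forall p, g p = v -> p = [:: v]} ->
  {in ps, forall p, g p = u -> p = [:: v]} -> {in ps &, injective g}.
Proof.
move=> gin gv gu p q pps qps gpq; apply/eqP/negPn/negP => pq.
have [_ _ H] := sys; have dis := H p q pps qps pq (g p).
have := gin p pps; rewrite inE => /predU1P[gpu|gp].
  by case/eqP: pq; rewrite (gu p) // (gu q) // -gpq.
have := gin q qps; rewrite -gpq inE => /predU1P[gpu|gq].
  by case/eqP: pq; rewrite (gu p) // (gu q) // -gpq.
by case/eqP: pq; have gpv := dis gp gq; rewrite (gv p) // (gv q) // -gpq.
Qed.

Lemma path_system_head : {in ps &, injective (head u)}.
Proof.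
have [_ H _] := sys; apply: path_system_inj => p /H[_];
  case: p => [|x p] /= lp; rewrite ?inE ?eqxx ?orbT //.
- by move: uv; rewrite -lp eqxx.
- move=> /and3P[_ xp _] xv; subst x; case: p lp xp => // x p /= lp.
  by rewrite -{1}lp mem_last.
- by move: uv; rewrite -lp eqxx.
- by case/andP=> /norP[/eqP ux _] _ xu; rewrite xu in ux.
Qed.

Lemma path_system_penultimate : {in ps &, injective (fun p => last u (belast u p))}.
Proof.
have [_ H _] := sys; apply: path_system_inj => p /H[_];
  case/lastP: p => [|p x]; rewrite ?last_rcons ?belast_rcons /=.
- by move=> lp; move: uv; rewrite -lp eqxx.
- move=> _ _; have := mem_last u p; rewrite !inE mem_rcons inE.
  by case/orP=> ->; rewrite ?orbT.
- by move=> lp; move: uv; rewrite -lp eqxx.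
- move=> -> /andP[_]; rewrite rcons_uniq => /andP[vp _] lv.
  have := mem_last u p; rewrite lv inE (negPf vp) orbF => /eqP vu.
  by move: uv; rewrite vu eqxx.
- by move=> lp; move: uv; rewrite -lp eqxx.
- move=> -> /andP[]; rewrite mem_rcons inE => /norP[_ up] _ lu.
  by case: p up lu => // x' p up lu; rewrite -lu /= mem_last in up.
Qed.

End PathSystem.

(** The predecessor and the successor of [x] on the cycle already use up its degree 2. *)
Lemma cycle_closed (V : finType) (e : rel V) (c : seq V) (x w : V) :
  symmetric e -> (forall z, #|e z| <= 2) -> uniq c -> cycle e c -> 2 < size c ->
  x \in c -> e x w -> w \in c.
Proof.
move=> e_sym deg2 uc cc sc xc xw; have [i s rc] := rot_to xc.
rewrite -(mem_rot i) rc; rewrite -(rot_cycle i) rc in cc.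
rewrite -(rot_uniq i) rc in uc; rewrite -(size_rot i) rc in sc.
case: s => [|y s] in rc cc uc sc *; first by [].
case/lastP: s => [|s z] in rc cc uc sc *; first by [].
move: cc; rewrite /= !rcons_path last_rcons => /and3P[xy _ zx].
rewrite e_sym in zx.
have yz : y != z.
  by move: uc => /= /and3P[_ /negP ys _]; apply/eqP => yz; apply: ys; rewrite yz mem_rcons mem_head.
rewrite !inE mem_rcons inE; apply/negPn/negP => /norP[_ /norP[wy /norP[wz _]]].
have /uniq_leq_size H : uniq [:: w; y; z] by rewrite /= !inE negb_or wy wz yz.
have := H (enum (e x)); rewrite -cardE leqNgt => /(_ _)/negP; case; last by rewrite ltnS.
by move=> t; rewrite !inE mem_enum => /or3P[]/eqP->.
Qed.

(** * Degrees, sizes and connectivity of colour classes *)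

Section ColourClasses.
Variables (S T K : finType) (f : S -> T -> K).
Local Notation V := (S + T)%type.
Implicit Types (i : K) (u v w : V).

Definition cadj i : rel V := fun u v =>
  match u, v with
  | inl x, inr y | inr y, inl x => f x y == i
  | _, _ => false
  end.
Definition deg i u := #|cadj i u|.
Definition esize i := #|[set z : S * T | f z.1 z.2 == i]|.
Definition touchS i := #|[set x | 0 < deg i (inl x)]|.
Definition touchT i := #|[set y | 0 < deg i (inr y)]|.

Definition mono u p := [exists i, path (cadj i) u p].

Lemma cadj_sym i : symmetric (cadj i). Proof. by case=> [x|y] [x'|y']. Qed.

Lemma deg_inl i x : deg i (inl x) = \sum_y (f x y == i).
Proof.
rewrite /deg -sum1_card big_mkcond big_sumType /= big1 ?add0n //.
Qed.

Lemma deg_inr i y : deg i (inr y) = \sum_x (f x y == i).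
Proof.
rewrite /deg -sum1_card big_mkcond big_sumType /= [X in _ + X]big1 ?addn0 //.
Qed.

Lemma esize_sumS i : esize i = \sum_x deg i (inl x).
Proof.
under eq_bigr do rewrite deg_inl; rewrite pair_bigA /= /esize -sum1dep_card.
by rewrite big_mkcond; apply: eq_bigr => -[x y] _ /=; case: eqP.
Qed.

Lemma esize_sumT i : esize i = \sum_y deg i (inr y).
Proof.
rewrite esize_sumS; under eq_bigr do rewrite deg_inl.
by rewrite exchange_big; apply: eq_bigr => y _; rewrite deg_inr.
Qed.

Lemma sum_esize : \sum_i esize i = #|S| * #|T|.
Proof.
under eq_bigr do rewrite /esize -sum1dep_card.
rewrite -card_prod -sum1_card (partition_big (fun z => f z.1 z.2) predT) //=.
Qed.

Lemma esize_gt0_of i x y : f x y = i -> 0 < esize i.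
Proof. by move=> fxy; apply/card_gt0P; exists (x, y); rewrite inE /= fxy. Qed.

Lemma count_le_deg i u ps (g : seq V -> V) z : {in ps &, injective g} -> uniq ps ->
  {in ps, forall p, path (cadj i) u p -> cadj i z (g p)} ->
  count (path (cadj i) u) ps <= deg i z.
Proof.
move=> ginj ups gz; rewrite -size_filter -(size_map g) /deg cardE.
apply: uniq_leq_size.
  rewrite map_inj_in_uniq ?filter_uniq // => p q.
  by rewrite !mem_filter => /andP[_ pps] /andP[_ qps]; apply: ginj.
move=> w /mapP[p]; rewrite mem_filter => /andP[pi pps] ->.
by rewrite mem_enum; apply: gz.
Qed.

Section Pairs.
Variables (u v : V) (ps : seq (seq V)).
Hypotheses (uv : u != v) (sys : path_system mono u v ps).

Lemma count_le_deg_source i : count (path (cadj i) u) ps <= deg i u.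
Proof.
have [ups H _] := sys; apply: count_le_deg (path_system_head uv sys) ups _.
move=> p /H[_ lp _]; case: p lp => [/= lp|x p _ /= /andP[]//].
by move: uv; rewrite -lp eqxx.
Qed.

Lemma count_le_deg_target i : count (path (cadj i) u) ps <= deg i v.
Proof.
have [ups H _] := sys; apply: count_le_deg (path_system_penultimate uv sys) ups _.
move=> p /H[_ lp _]; case/lastP: p lp => [/= lp|p x].
  by move: uv; rewrite -lp eqxx.
by rewrite last_rcons => ->; rewrite rcons_path belast_rcons /= cadj_sym => /andP[].
Qed.

Lemma size_le_count : size ps <= \sum_i count (path (cadj i) u) ps.
Proof.
have [_ H _] := sys; elim: ps H => //= p qs IH H.
rewrite big_split /= -add1n leq_add //.
  have [/existsP[i pi] _ _] := H p (mem_head _ _).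
  by rewrite (bigD1 i) //= pi.
by apply: IH => q qqs; apply: H; rewrite inE qqs orbT.
Qed.

Lemma size_le_common : size ps <= \sum_i minn (deg i u) (deg i v).
Proof.
apply: leq_trans size_le_count _; apply: leq_sum => i _.
by rewrite leq_min count_le_deg_source count_le_deg_target.
Qed.

End Pairs.

(** A path between two vertices of [S] continues past its first vertex [y] in the same colour, which
    gives [y] degree at least 2 in that colour. These first vertices are distinct. *)
Lemma size_le_branching x x' ps : x != x' -> path_system mono (inl x) (inl x') ps ->
  size ps <= #|[set y | [exists i, 1 < deg i (inr y)]]|.
Proof.
move=> xx' sys; have uv : inl x != inl x' :> V by [].
rewrite -(size_map (head (inl x))) cardE -(size_map (@inr S T)).
have [ups H _] := sys; apply: uniq_leq_size.
  by rewrite map_inj_in_uniq //; apply: path_system_head uv sys.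
move=> _ /mapP[p pps ->]; have [/existsP[i pi] lp up] := H p pps.
case: p pps lp up pi => [|[//|y] p] _ /= lp.
  by move: uv; rewrite -lp eqxx.
case: p lp => [//|[x''|y''] p] _; last by move=> _ /and3P[].
rewrite !inE !negb_or => /andP[/and3P[_ nx _] _] /and3P[fxy fxy' _].
rewrite mem_map; last by move=> ? ? [].
rewrite mem_enum inE; apply/existsP; exists i.
have -> : 2 = #|[set inl x; inl x'' : V]| by rewrite cards2 nx.
by apply: subset_leq_card; apply/subsetP => w; rewrite !inE => /orP[]/eqP->.
Qed.

(** The first vertices of the paths exhaust [S]. A path of length more than 2 would meet a second
    vertex of [S], which is the first vertex of another path. So all paths have length 2. *)
Lemma tight_paths y y' ps : y != y' -> path_system mono (inr y) (inr y') ps ->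
  size ps = #|S| -> forall x, f x y = f x y'.
Proof.
move=> yy' sys sps x; have uv : inr y != inr y' :> V by [].
have [ups H dis] := sys.
have [||| _ heads] := @uniq_min_size _ (map (head (inr y)) ps) (map inl (enum S)).
- by rewrite map_inj_in_uniq //; apply: path_system_head uv sys.
- move=> _ /mapP[p pps ->]; have [/existsP[i pi] lp _] := H p pps.
  case: p pps lp pi => [|[x0|//] p] _ /= lp _.
    by move: uv; rewrite -lp eqxx.
  by rewrite map_f // mem_enum.
- by rewrite size_map -cardE size_map sps.
have headP x0 : exists2 p, p \in ps & inl x0 = head (inr y) p.
  by apply/mapP; rewrite heads map_f // mem_enum.
have [p pps hp] := headP x; have [/existsP[i pi] lp up] := H p pps.
case: p hp pi lp up pps => [//|_ p] /= <- /andP[/eqP fxy].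
case: p => [|[z|y1] p] //= /andP[/eqP fxy1].
case: p => [|[x2|z] p] //=; first by move=> _ [<-]; rewrite fxy.
move=> _.
move=> _ /andP[_ /andP[nx2 _]] pps.
have [q qps hq] := headP x2.
have : inl x2 = inr y' :> V; last by [].
apply: (dis _ _ pps qps); last 1 first.
- by case: q hq qps => //= z q -> _; rewrite mem_head.
- apply/eqP => pq; rewrite -pq /= in hq; case: hq => hq.
  by move: nx2; rewrite hq !inE eqxx orbT.
- by rewrite !inE eqxx !orbT.
Qed.

(** The paths [p] and [q] form a cycle. As the class is connected, spanning and of maximum degree 2,
    this cycle contains every vertex, including the first interior vertex of [r]. *)
Lemma two_regular_class i y y' ps p q r : y != y' ->
  path_system mono (inr y) (inr y') ps ->
  (forall w, deg i w <= 2) -> (forall w w', connect (cadj i) w w') ->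
  p \in ps -> q \in ps -> r \in ps -> p != q -> p != r -> q != r ->
  path (cadj i) (inr y) p -> path (cadj i) (inr y) q -> False.
Proof.
move=> yy' sys deg2 conn pps qps rps pq pr qr pi qi.
have uv : inr y != inr y' :> V by [].
have [ups H dis] := sys.
have [_ lp] := H p pps; rewrite cons_uniq => /andP[up1 up2].
have [_ lq] := H q qps.
have [mr lr _] := H r rps.
case/lastP: q qps pq qr qi lq => [|q v] qps pq qr qi.
  by move=> lq; move: uv; rewrite -lq eqxx.
rewrite last_rcons cons_uniq => vE; subst v => /andP[uq1 uq2].
have [x xr] : exists x, inl x \in r.
  case/existsP: mr => j rj; case: r rj lr {rps pr qr} => [|[x|y1] r] //=.
    by move=> _ lr; move: uv; rewrite lr eqxx.
  by exists x; rewrite mem_head.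
(* At this point [q] has lost its last vertex [inr y'], which is already the last vertex of [p]. *)
pose c := inr y :: p ++ rev q.
have vq : inr y' \notin q by move: uq2; rewrite rcons_uniq => /andP[].
have cc : cycle (cadj i) c.
  rewrite /c /= rcons_cat cat_path pi lp /= -rev_cons.
  have := rev_path (cadj i) (inr y) (rcons q (inr y')).
  rewrite last_rcons belast_rcons => ->.
  by rewrite (eq_path (e' := cadj i)) // => a b; rewrite cadj_sym.
have uc : uniq c.
  rewrite /c cons_uniq mem_cat mem_rev negb_or up1 cat_uniq up2 rev_uniq /=.
  move: uq1 uq2; rewrite mem_rcons inE rcons_uniq => /norP[_ ->] /andP[_ ->] /=.
  rewrite andbT; apply/hasPn => z; rewrite mem_rev => zq; apply/negP => zp.
  have zE := dis _ _ pps qps pq z zp.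
  by move: vq; rewrite -zE ?zq // mem_rcons inE zq orbT.
have sc : 2 < size c.
  rewrite /= size_cat ltnS; case: p pi lp {pps pq pr up1 up2 c cc uc} => [|[x0|//] [|z p]] //=.
  by move=> _ lp; move: uv; rewrite -lp eqxx.
have xc : inl x \in c.
  have cl : closed (cadj i) (mem c).
    apply: intro_closed; first exact/sym_connect_sym/cadj_sym.
    by move=> a b ab ac; apply: cycle_closed (@cadj_sym i) deg2 uc cc sc ac ab.
  by rewrite -(closed_connect cl (conn (inr y) (inl x))) mem_head.
move: xc; rewrite inE mem_cat mem_rev /= => /orP[xp|xq].
  by have := dis _ _ pps rps pr _ xp xr.
by have := dis _ _ qps rps qr (inl x); rewrite mem_rcons inE xq orbT => /(_ isT xr).
Qed.

Definition connected_classes := forall i u v, 0 < deg i u -> 0 < deg i v -> connect (cadj i) u v.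

(** A connected graph with [n] edges has at most [n + 1] vertices: a vertex set is grown one vertex
    at a time along an edge leaving it, and each such edge is new. *)
Lemma touch_le_esize i : connected_classes -> 0 < esize i ->
  touchS i + touchT i <= (esize i).+1.
Proof.
move=> conn /card_gt0P[[x0 y0]]; rewrite inE /= => /eqP fi.
pose X := [set u | 0 < deg i u].
have -> : touchS i + touchT i = #|X|.
  by rewrite /touchS /touchT /X -!sum1dep_card big_sumType.
pose E (Y : {set V}) := [set z : S * T | [&& f z.1 z.2 == i, inl z.1 \in Y & inr z.2 \in Y]].
have degX u w : cadj i u w -> u \in X by rewrite inE => uw; apply/card_gt0P; exists w.
have rX : inl x0 \in X by apply: (degX _ (inr y0)); rewrite /= fi.
suff grow m : m < #|X| -> exists Y : {set V},
    [/\ Y \subset X, inl x0 \in Y, #|Y| = m.+1 & m <= #|E Y|].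
  have X0 : 0 < #|X| by apply/card_gt0P; exists (inl x0).
  have [|Y [_ _ _ leE]] := grow #|X|.-1; first by rewrite prednK.
  rewrite -(prednK X0) ltnS; apply: leq_trans leE _; apply: subset_leq_card.
  by apply/subsetP => z; rewrite !inE => /and3P[].
elim: m => [_|m IH ltm].
  exists [set inl x0]; rewrite sub1set rX inE eqxx cards1; split=> //.
have [Y [YX rY cY leE]] := IH (ltnW ltm).
have [a [b [aY bY ab]]] : exists a b, [/\ a \in Y, b \notin Y & cadj i a b].
  have /subsetPn[z zX zY] : ~~ (X \subset Y).
    by apply/negP => /subset_leq_card; rewrite cY leqNgt ltm.
  case: (pickP [pred ab : V * V | [&& ab.1 \in Y, ab.2 \notin Y & cadj i ab.1 ab.2]]).
    by move=> [a b] /and3P[? ? ?]; exists a, b.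
  move=> noab; case/negP: zY.
  have cl : closed (cadj i) (mem Y).
    apply: intro_closed; first exact/sym_connect_sym/cadj_sym.
    move=> a b ab aY; apply/negPn/negP => bY.
    by have := noab (a, b); rewrite /= aY bY ab.
  rewrite -(closed_connect cl (x := inl x0)) //.
  by apply: conn; [move: rX | move: zX]; rewrite inE.
exists (b |: Y); split.
- by rewrite subUset sub1set YX andbT; apply: (degX _ a); rewrite cadj_sym.
- by rewrite inE rY orbT.
- by rewrite cardsU1 bY cY.
apply: leq_ltn_trans leE _; apply: proper_card; apply/properP; split.
  by apply/subsetP => z; rewrite !inE => /and3P[-> -> ->]; rewrite !orbT.
case: a b aY bY ab => [x|y] [x'|y'] //= aY bY ab.
  by exists (x, y'); rewrite !inE /= ab aY ?eqxx ?orbT ?(negPf bY).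
by exists (x', y); rewrite !inE /= ab aY ?eqxx ?orbT ?(negPf bY).
Qed.

End ColourClasses.

(** * Lower bounds for the excess *)

Lemma sum_two (K : finType) (F : K -> nat) (j1 j2 : K) : j1 != j2 ->
  (forall i, i != j1 -> i != j2 -> F i = 0) -> \sum_i F i = F j1 + F j2.
Proof.
move=> j12 F0; rewrite (bigD1 j1) //= (bigD1 j2) /=; last by rewrite eq_sym.
by rewrite big1 ?addn0 // => i /andP[]; apply: F0.
Qed.

Lemma sum_ge2 (T : finType) (F : T -> nat) (y y' : T) : y != y' ->
  F y + F y' <= \sum_z F z.
Proof.
move=> yy'; rewrite (bigD1 y) //= (bigD1 y') /=; last by rewrite eq_sym.
by lia.
Qed.

(** A class with at most one edge has degree 0 at one of any two vertices of [T], so only [j1] and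
    [j2] contribute to the common degree. *)
Lemma two_classes (K T : finType) (d : K -> T -> nat) (k : nat) (j1 j2 : K) :
  (forall y y', y != y' -> k <= \sum_i minn (d i y) (d i y')) ->
  j1 != j2 -> (forall i, i != j1 -> i != j2 -> \sum_y d i y <= 1) ->
  1 < #|T| -> \sum_y d j1 y + \sum_y d j2 y = k * #|T| ->
  (forall y, d j1 y + d j2 y = k) /\ (forall y y', d j1 y = d j1 y').
Proof.
move=> common j12 small T1 sumd; apply: const_degrees => //.
  by rewrite big_split.
move=> y y' yy'; have := common y y' yy'; rewrite (sum_two j12) // => i i1 i2.
by have := small i i1 i2; have := sum_ge2 (d i) yy'; lia.
Qed.

Definition k_linked (S T K : finType) (f : S -> T -> K) (k : nat) :=
  forall u v, u != v -> exists2 ps, size ps = k & path_system (mono f) u v ps.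

Section UpperBounds.
Variables (S T K : finType) (f : S -> T -> K) (k s t : nat).
Hypotheses (conn : connected_classes f) (link : k_linked f k).
Hypotheses (k_ge2 : 1 < k) (cardS : #|S| = s) (cardT : #|T| = t).
Hypotheses (k_le_s : k <= s) (s_le_t : s <= t).

Local Notation n := (esize f).
Local Notation a := (touchT f).
Local Notation b := (touchS f).
Let W := \sum_i (n i - 1).

Lemma num_classes : #|[set i | 0 < n i]| + W = s * t.
Proof.
rewrite -cardS -cardT -(sum_esize f) -sum1dep_card big_mkcond /W -big_split /=.
by apply: eq_bigr => i _; case: (n i) => //= m; rewrite subn1.
Qed.

Let commonT y y' : y != y' -> k <= \sum_i minn (deg f i (inr y)) (deg f i (inr y')).
Proof.
move=> yy'; have uv : inr y != inr y' :> S + T by [].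
by have [ps <-] := link uv; apply: size_le_common.
Qed.

Let commonS x x' : x != x' -> k <= \sum_i minn (deg f i (inl x)) (deg f i (inl x')).
Proof.
move=> xx'; have uv : inl x != inl x' :> S + T by [].
by have [ps <-] := link uv; apply: size_le_common.
Qed.

Let a_le i : a i <= t. Proof. by rewrite -cardT max_card. Qed.
Let b_le i : b i <= s. Proof. by rewrite -cardS max_card. Qed.

Let esize_touchT i : n i = a i + \sum_y (deg f i (inr y) - 1).
Proof.
rewrite esize_sumT /touchT -sum1dep_card [X in _ = X + _]big_mkcond -big_split /=.
by apply: eq_bigr => y _; case: (deg _ _ _) => //= m; rewrite subn1.
Qed.

Let a_len i : a i <= n i. Proof. by rewrite esize_touchT leq_addr. Qed.

Let a_gt0 i : 0 < n i -> 0 < a i.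
Proof.
move=> ni; rewrite lt0n; apply/negP => a0.
have : n i = \sum_(y : T) 0; last by rewrite big1 //; lia.
rewrite esize_sumT; apply: eq_bigr => y _; apply/eqP; rewrite -leqn0 leqNgt.
by apply/negP => dy; move: a0; rewrite cards_eq0 => /eqP/setP/(_ y); rewrite !inE dy.
Qed.

Let b_gt0 i : 0 < n i -> 0 < b i.
Proof.
move=> ni; rewrite lt0n; apply/negP => b0.
have : n i = \sum_(x : S) 0; last by rewrite big1 //; lia.
rewrite esize_sumS; apply: eq_bigr => x _; apply/eqP; rewrite -leqn0 leqNgt.
by apply/negP => dx; move: b0; rewrite cards_eq0 => /eqP/setP/(_ x); rewrite !inE dx.
Qed.

Let b_len i : b i <= n i.
Proof.
rewrite esize_sumS /touchS -sum1dep_card big_mkcond /=.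
by apply: leq_sum => x _; case: ifP.
Qed.

Let deg_full_T i : t <= a i -> forall y, 0 < deg f i (inr y).
Proof.
move=> ai y; have /eqP/setP/(_ y) : [set y | 0 < deg f i (inr y)] == [set: T].
  by rewrite eqEcard subsetT cardsT cardT.
by rewrite !inE.
Qed.

Let full := [set i | a i - 1 == t - 1].

Let pairsT : k * t * (t - 1) <= \sum_i n i * (a i - 1).
Proof.
have := pair_count (d := fun i y => deg f i (inr y)) commonT.
by rewrite cardT; under eq_bigr do rewrite -esize_sumT.
Qed.

Let pairsS : k * s * (s - 1) <= \sum_i n i * (b i - 1).
Proof.
have := pair_count (d := fun i x => deg f i (inl x)) commonS.
by rewrite cardS; under eq_bigr do rewrite -esize_sumS.
Qed.

(** Since [t >= 2], the extremal weight [t - 1] is attained exactly by the classes that touch all of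
    [T]. *)
Lemma excess_full : k * t <= W + #|full|.
Proof.
apply: (@extremal_sum _ n (fun i => a i - 1) (t - 1)) => //; first by lia.
  by move=> i; apply: leq_sub2r.
by move=> i; apply: leq_sub2r.
Qed.

(** A nonempty class has [n i - 1] equal to [a i - 1] plus its surplus degrees in [T]. At least [k]
    vertices of [T] have such a surplus, by [size_le_branching]. *)
Lemma excess_ge_touch : \sum_i (a i - 1) + k <= W.
Proof.
have [x [x' xx']] : exists x x' : S, x != x'.
  have /card_gt1P[x [x' [_ _ xx']]] : 1 < #|S| by lia.
  by exists x, x'.
have uv : inl x != inl x' :> S + T by [].
have [ps sps sys] := link uv.
have kle : k <= \sum_i \sum_y (deg f i (inr y) - 1).
  rewrite -sps exchange_big /=; apply: leq_trans (size_le_branching xx' sys) _.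
  rewrite -sum1dep_card big_mkcond /=; apply: leq_sum => y _.
  case: ifP => // /existsP[i di]; rewrite (bigD1 i) //=; lia.
apply: leq_trans (leq_add (leqnn _) kle) _; rewrite -big_split /=.
apply: leq_sum => i _; have := esize_touchT i; have := @a_gt0 i; lia.
Qed.

Let full_le : #|full| * (t - 1) <= \sum_i (a i - 1).
Proof.
rewrite -sum_nat_const big_mkcond /=; apply: leq_sum => i _.
by rewrite inE; case: eqP => // ->.
Qed.

(** With [p] full classes, [k * t <= W + p] suffices when [p <= k], and [p * (t - 1) + k <= W]
    suffices otherwise. *)
Lemma excess_ge : k * (t - 1) <= W.
Proof. by have := excess_full; have := full_le; have := excess_ge_touch; nia. Qed.

(** A connected class with [t] edges that covers [T] touches a single [x0] in [S], so it contains
    all edges at [x0]. Then [x0] shares no colour with any other vertex of [S]. *)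
Let no_star j : (forall y, deg f j (inr y) = 1) -> False.
Proof.
move=> d1; have nj : n j = t by rewrite esize_sumT (eq_bigr (fun=> 1)) ?sum1_card ?cardT.
have aj : t <= a j by have := esize_touchT j; rewrite big1 ?addn0 -?nj => [->|y _]; rewrite ?d1.
have nj0 : 0 < n j by rewrite nj; lia.
have bj : b j <= 1 by have := touch_le_esize conn nj0; rewrite nj; lia.
have fj y : exists x, f x y == j.
  have : 0 < deg f j (inr y) by rewrite d1.
  by case/card_gt0P=> -[x|//] xy; exists x.
have touched x y : f x y == j -> 0 < deg f j (inl x).
  by move=> xy; apply/card_gt0P; exists (inr y).
have /card_gt0P[y0 _] : 0 < #|T| by lia.
have [x0 xy0] := fj y0; have x0t := touched _ _ xy0.
have only x : 0 < deg f j (inl x) -> x = x0.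
  by move=> xt; apply: (card_le1_eqP bj); rewrite inE.
have allj y : f x0 y = j.
  by have [x xy] := fj y; rewrite -(only x) ?(eqP xy) //; apply: touched xy.
have [x1 x01] : exists x1, x0 != x1.
  have : 0 < #|predC1 x0| by rewrite cardC1 cardS; lia.
  by case/card_gt0P=> x1 /[!inE]; rewrite eq_sym; exists x1.
have := commonS x01; rewrite big1 ?leqn0; first by lia.
move=> i _; have [->|ij] := eqVneq i j.
  have [->|/only xx] := posnP (deg f j (inl x1)); first by rewrite minn0.
  by rewrite xx eqxx in x01.
by rewrite deg_inl big1 ?min0n // => y _; rewrite allj eq_sym (negPf ij).
Qed.

Lemma excess_k23 : k <= 3 -> k * t <= W.+1.
Proof.
move=> k3; rewrite leqNgt; apply/negP => ltW.
have pge := excess_full; have Wge := excess_ge_touch; have ple := full_le.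
(* The assumption [W <= k * t - 2] gives at least two full classes, and [excess_ge_touch] allows
   fewer than [k]. *)
have p2 : #|full| = 2 by nia.
have k3' : k = 3 by nia.
have /cards2P[j1 [j2 [j12 fullE]]] : #|full| == 2 by rewrite p2.
have aF j : j \in full -> t <= a j.
  by rewrite inE => /eqP aj; have := a_le j; lia.
have a1 : t <= a j1 by apply: aF; rewrite fullE !inE eqxx.
have a2 : t <= a j2 by apply: aF; rewrite fullE !inE eqxx orbT.
have small i : i != j1 -> i != j2 -> n i <= 1.
  move=> i1 i2; rewrite leqNgt; apply/negP => ni.
  have iF : a i - 1 != t - 1.
    have : i \notin full by rewrite fullE !inE negb_or i1.
    by rewrite inE.
  have [|||||||ai wi] := @extremal_sum_eq _ n (fun i => a i - 1) (t - 1) (k * t) _ _ _ _ i.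
  - by lia.
  - by move=> j; apply: leq_sub2r.
  - by move=> j; apply: leq_sub2r.
  - exact: pairsT.
  - by rewrite -/W -/full; lia.
  - by lia.
  - by rewrite ltn_neqAle iF leq_sub2r.
  case/orP: wi => /eqP /= wi; first by lia.
  (* Here [i] misses just one vertex of [T]. Together with [j1] and [j2] it makes [W] at least
     [3 * t - 1]. *)
  have : \sum_i (a i - 1) >= 3 * (t - 1) - 1; last by lia.
  rewrite (bigD1 j1) //= (bigD1 j2) /=; last by rewrite eq_sym.
  rewrite (bigD1 i) /=; last by rewrite i1.
  by lia.
have n1 := a_len j1; have n2 := a_len j2.
have Wtwo : W = (n j1 - 1) + (n j2 - 1).
  by apply: sum_two => // i i1 i2; have := small i i1 i2; lia.
have [|||dsum dconst] := @two_classes _ _ (fun i y => deg f i (inr y)) k j1 j2 commonT j12.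
- by move=> i i1 i2; rewrite -esize_sumT; apply: small.
- by lia.
- by rewrite -!esize_sumT cardT; lia.
have /card_gt0P[y0 _] : 0 < #|T| by lia.
have d1 := deg_full_T a1; have d2 := deg_full_T a2.
(* Two positive constant degrees with sum 3: one of them is 1. *)
have [d1E|d1E] := eqVneq (deg f j1 (inr y0)) 1.
  by apply: (@no_star j1) => y; rewrite (dconst y y0).
apply: (@no_star j2) => y; have := dsum y; have := d2 y; have := d1 y0.
by rewrite (dconst y y0); lia.
Qed.

(** * Equal sides: counting pairs in both classes *)

Section Square.
Hypothesis eq_st : s = t.

Let w i := (a i - 1) + (b i - 1).
Let M := 2 * (t - 1).
Let spanning := [set i | w i == M].

Let w_leM i : w i <= M.
Proof. by rewrite /w /M; have := a_le i; have := b_le i; lia. Qed.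

Let w_len i : w i <= n i - 1.
Proof.
have [ni|ni] := posnP (n i).
  by rewrite /w; have := a_len i; have := b_len i; lia.
have := touch_le_esize conn ni; have := a_gt0 ni; have := b_gt0 ni; rewrite /w; lia.
Qed.

Let pairsST : k * t * M <= \sum_i n i * w i.
Proof.
under eq_bigr do rewrite mulnDr; rewrite big_split /=.
by have := pairsT; have := pairsS; rewrite /M eq_st; nia.
Qed.

Lemma excess_spanning : k * t <= W + #|spanning|.
Proof. by apply: (@extremal_sum _ n w M) => //; rewrite /M; lia. Qed.

Let sum_w_le : \sum_i w i <= W. Proof. exact: leq_sum. Qed.

Let spanning_le : #|spanning| * M <= \sum_i w i.
Proof.
rewrite -sum_nat_const big_mkcond /=; apply: leq_sum => i _.
by rewrite inE; case: eqP => // ->.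
Qed.

(** With [q] spanning classes, [k * t <= W + q] suffices when [2 * q <= t + 2]. Otherwise these
    classes alone cost [q * M], which is enough because [k <= t]. *)
Lemma excess_square : (2 * k - 1) * t <= 2 * W + 2.
Proof.
have := excess_spanning; have := spanning_le; have := sum_w_le; rewrite /M.
move: #|spanning| (\sum_i w i) => q w' h1 h2 h3.
have [q2|q2] := leqP (2 * q) (t + 2); first by nia.
have : (t + 3) * (2 * t - 2) <= 2 * W by nia.
by nia.
Qed.

(** The degrees allow at most 2 paths in [j1], [k - 2] in [j2] and none elsewhere, so all these
    numbers are attained. The two paths in [j1] then leave no vertex for one in [j2]. *)
Let no_hamilton_pair j1 j2 : j1 != j2 ->
  (forall i, i != j1 -> i != j2 -> n i <= 1) -> 2 < k ->
  (forall u, deg f j1 u = 2) -> (forall u, deg f j2 u = k - 2) -> False.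
Proof.
move=> j12 small k3 d1 d2.
have [y [y' yy']] : exists y y' : T, y != y'.
  have /card_gt1P[y [y' [_ _ yy']]] : 1 < #|T| by lia.
  by exists y, y'.
have uv : inr y != inr y' :> S + T by [].
have [ps sps sys] := link uv; have [ups _ _] := sys.
have := size_le_count sys; rewrite sps (sum_two j12); last first.
  move=> i i1 i2; have := small i i1 i2; rewrite esize_sumT.
  have := sum_ge2 (fun y => deg f i (inr y)) yy'.
  by have := count_le_deg_source uv sys i; have := count_le_deg_target uv sys i; lia.
have := count_le_deg_source uv sys j1; have := count_le_deg_source uv sys j2.
rewrite d1 d2 => c2 c1 c12.
have /hasP[r rps rj] : has (path (cadj f j2) (inr y)) ps by rewrite has_count; lia.
have : size (filter (path (cadj f j1) (inr y)) ps) = 2 by rewrite size_filter; lia.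
move: (filter_uniq (path (cadj f j1) (inr y)) ups) (mem_filter (path (cadj f j1) (inr y)) ^~ ps).
case: (filter _ _) => [|p [|q []]] // upq mempq _.
have := mempq p; rewrite mem_head => /esym/andP[pj pps].
have := mempq q; rewrite !inE eqxx orbT => /esym/andP[qj qps].
have pq : p != q by move: upq; rewrite /= inE => /andP[].
have ne p0 : path (cadj f j1) (inr y) p0 -> p0 != r.
  move=> pj0; apply/eqP => pr; rewrite -{}pr in rj rps.
  have [_ /(_ p0 rps)[_ lp _] _] := sys.
  case: p0 pj0 rj lp {rps} => [|[x|//] p0] /=; first by move=> _ _ lp; rewrite lp eqxx in uv.
  by case/andP=> /eqP -> _ /andP[/eqP jj]; rewrite jj eqxx in j12.
apply: (@two_regular_class _ _ _ f j1 y y' ps p q r) => //; try exact: ne.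
  by move=> u; rewrite d1.
by move=> u v; apply: conn; rewrite d1.
Qed.

Lemma excess_k45 : 3 < k <= 5 -> k < t -> k * t <= W.+1.
Proof.
move=> /andP[k4 k5] kt; rewrite leqNgt; apply/negP => ltW.
have := excess_spanning; have := spanning_le; have := sum_w_le => sw sp qge.
(* Three spanning classes would cost [6 * (t - 1)], more than [k * t - 2] since [k <= 5] and
   [k < t]. *)
have q2 : #|spanning| = 2 by move: sp; rewrite /M; nia.
have /cards2P[j1 [j2 [j12 spE]]] : #|spanning| == 2 by rewrite q2.
have wF j : j \in spanning -> w j = M by rewrite inE => /eqP.
have w1 : w j1 = M by apply: wF; rewrite spE !inE eqxx.
have w2 : w j2 = M by apply: wF; rewrite spE !inE eqxx orbT.
have small i : i != j1 -> i != j2 -> n i <= 1.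
  move=> i1 i2; rewrite leqNgt; apply/negP => ni.
  have iF : w i != M.
    have : i \notin spanning by rewrite spE !inE negb_or i1.
    by rewrite inE.
  have [|||||||ni' wi] := @extremal_sum_eq _ n w M (k * t) _ _ _ _ i => //.
  - by rewrite /M; lia.
  - by rewrite -/W -/spanning; lia.
  - by lia.
  - by rewrite ltn_neqAle iF w_leM.
  case/orP: wi => /eqP /= wi; first by lia.
  have : \sum_i w i >= 3 * M - 1; last by rewrite /M; nia.
  rewrite (bigD1 j1) //= (bigD1 j2) /=; last by rewrite eq_sym.
  rewrite (bigD1 i) /=; last by rewrite i1.
  lia.
have n1 := w_len j1; have n2 := w_len j2.
have M0 : 0 < M by rewrite /M; lia.
have Wtwo : W = (n j1 - 1) + (n j2 - 1).
  by apply: sum_two => // i i1 i2; have := small i i1 i2; lia.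
have [|||dTsum dTconst] := @two_classes _ _ (fun i y => deg f i (inr y)) k j1 j2 commonT j12.
- by move=> i i1 i2; rewrite -esize_sumT; apply: small.
- by lia.
- by rewrite -!esize_sumT cardT; lia.
have [|||dSsum dSconst] := @two_classes _ _ (fun i x => deg f i (inl x)) k j1 j2 commonS j12.
- by move=> i i1 i2; rewrite -esize_sumS; apply: small.
- by lia.
- by rewrite -!esize_sumS cardS; lia.
have /card_gt0P[y0 _] : 0 < #|T| by lia.
have /card_gt0P[x0 _] : 0 < #|S| by lia.
have nT : n j1 = t * deg f j1 (inr y0).
  by rewrite esize_sumT -cardT -sum_nat_const; apply: eq_bigr => y _; apply: dTconst.
have nS : n j1 = t * deg f j1 (inl x0).
  by rewrite esize_sumS -eq_st -cardS -sum_nat_const; apply: eq_bigr => x _; apply: dSconst.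
set d := deg f j1 (inr y0) in nT.
have dS : deg f j1 (inl x0) = d by nia.
have D1 u : deg f j1 u = d.
  by case: u => [x|y]; [rewrite (dSconst x x0) | rewrite (dTconst y y0)].
have D2 u : deg f j2 u = k - d.
  by case: u => [x|y]; [have := dSsum x | have := dTsum y]; rewrite D1; lia.
have n2E : n j2 = t * (k - d).
  by rewrite esize_sumT -cardT -sum_nat_const; apply: eq_bigr => y _; apply: D2.
(* A spanning class has at least [2 * t - 1] edges, so its constant degree is at least 2. As
   [k <= 5], one of [d] and [k - d] equals 2. *)
have d_ge : 2 <= d by move: n1; rewrite w1 /M; nia.
have d_le : 2 <= k - d by move: n2; rewrite w2 /M; nia.
have [d2|d2] := eqVneq d 2.
  by apply: (no_hamilton_pair j12 small); rewrite ?d2 // -?d2 //; lia.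
have kd2 : k - d = 2 by lia.
apply: (@no_hamilton_pair j2 j1); rewrite 1?eq_sym //; first by move=> i ? ?; apply: small.
- by lia.
- by move=> u; rewrite D2.
- by move=> u; rewrite D1; lia.
Qed.

End Square.

End UpperBounds.

(** By [tight_paths] all edges at a vertex of [S] have one colour. Two vertices of [S] with
    different colours would have no colour in common. *)
Lemma one_class (S T K : finType) (f : S -> T -> K) (k : nat) : k_linked f k ->
  #|S| = k -> 0 < k -> forall x x' y y', f x y = f x' y'.
Proof.
move=> link cardS k0.
have const y y' x : f x y = f x y'.
  have [->//|yy'] := eqVneq y y'; have uv : inr y != inr y' :> S + T by [].
  by have [ps sps sys] := link _ _ uv; apply: (tight_paths yy' sys); rewrite sps cardS.
move=> x x' y y'; rewrite (const y y'); have [->//|xx'] := eqVneq x x'.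
have uv : inl x != inl x' :> S + T by [].
have [ps sps sys] := link _ _ uv.
have := size_le_common uv sys; rewrite sps leqNgt => /negP Hc.
apply/eqP/negPn/negP => ne; case: Hc.
rewrite big1; first by lia.
move=> i _; have [fi|fi] := eqVneq (f x y') i.
  rewrite [X in minn _ X]deg_inl big1 ?minn0 // => z _.
  by rewrite (const z y') -fi eq_sym (negPf ne).
by rewrite deg_inl big1 ?min0n // => z _; rewrite (const z y') (negPf fi).
Qed.

(** * Colourings of the complete bipartite graph *)

Section Refinement.
Variables (S T K : finType) (f : S -> T -> K).

Definition component i u := [set w | connect (cadj f i) u w].

(** A monochromatic path stays in one component of its colour class, so this recolouring keeps all
    path systems while making the classes connected. *)
Definition refine x y := (f x y, component (f x y) (inl x)).

Lemma component_cadj i u w : cadj f i u w -> component i u = component i w.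
Proof.
move=> uw; apply/setP => z; rewrite !inE.
exact/same_connect/connect1/uw/sym_connect_sym/cadj_sym.
Qed.

Lemma cadj_refine i C u w :
  cadj refine (i, C) u w = cadj f i u w && (component i u == C).
Proof.
case: u w => [x|y] [x'|y'] //=; rewrite xpair_eqE /=; case: eqP => //= fi.
  by rewrite fi.
by rewrite fi (@component_cadj i (inr y) (inl x')) //= fi.
Qed.

Lemma path_refine i u p : path (cadj f i) u p ->
  path (cadj refine (i, component i u)) u p.
Proof.
elim: p u => //= w p IH u /andP[uw wp]; rewrite cadj_refine uw eqxx /=.
by rewrite (component_cadj uw) IH.
Qed.

Lemma k_linked_refine k : k_linked f k -> k_linked refine k.
Proof.
move=> link u v uv; have [ps sps [ups H dis]] := link u v uv.
exists ps => //; split=> // p /H[/existsP[i pi] lp up]; split=> //.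
by apply/existsP; exists (i, component i u); apply: path_refine.
Qed.

Lemma connected_refine : connected_classes refine.
Proof.
move=> [i C] u v /card_gt0P[u' +] /card_gt0P[v'].
rewrite -!topredE /= !cadj_refine => /andP[_ /eqP uC] /andP[_ /eqP vC].
have : v \in component i u by rewrite uC -vC inE connect0.
rewrite inE => /connectP[p up ->]; apply/connectP; exists p => //.
by rewrite -uC; apply: path_refine.
Qed.

Lemma num_classes_refine :
  #|[set i | 0 < esize f i]| <= #|[set i | 0 < esize refine i]|.
Proof.
apply: leq_trans (leq_imset_card fst _); apply: subset_leq_card.
apply/subsetP => i; rewrite inE => /card_gt0P[[x y]]; rewrite inE /= => /eqP fi.
apply/imsetP; exists (refine x y); last by rewrite /= fi.
by rewrite inE; apply: esize_gt0_of (erefl _).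
Qed.

End Refinement.

Section Bipartite.
Variables s t : nat.
Local Notation V := ('I_s + 'I_t)%type.
Local Notation adj := (@Kbip_adj s t).

Definition edge (x : 'I_s) (y : 'I_t) : {set V} := [set inl x; inr y].

Lemma edge_inj x y x' y' : edge x y = edge x' y' -> x = x' /\ y = y'.
Proof.
move=> /setP E; have := E (inl x); have := E (inr y); rewrite !inE !eqxx /=.
by move=> /esym/eqP[->] /esym; rewrite orbF => /eqP[->].
Qed.

Lemma mem_edges e : reflect (exists x y, e = edge x y) (e \in edges adj).
Proof.
rewrite inE; apply: (iffP existsP) => [[u /existsP[v /andP[uv /eqP->]]]|[x [y ->]]].
  case: u v uv => [x|y] [x'|y'] // _; first by exists x, y'.
  by exists x', y; rewrite /edge setUC.
by exists (inl x); apply/existsP; exists (inr y); rewrite /= eqxx.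
Qed.

Lemma card_edges : #|edges adj| = s * t.
Proof.
have -> : edges adj = [set edge z.1 z.2 | z in [set: 'I_s * 'I_t]].
  apply/setP => e; apply/mem_edges/imsetP => [[x [y ->]]|[[x y] _ ->]].
    by exists (x, y).
  by exists x, y.
rewrite card_imset ?cardsT ?card_prod ?card_ord // => -[x y] [x' y'] /=.
by case/edge_inj=> -> ->.
Qed.

Section Colouring.
Variable c : colouring adj.
Let f x y := c (edge x y).

Lemma cadj_colouring i u v : cadj f i u v = adj u v && (c [set u; v] == i).
Proof. by case: u v => [x|y] [x'|y'] //=; rewrite /f /edge setUC. Qed.

Lemma mono_colouring u v p : u != v -> is_path adj u v p -> Defs.mono_path c u p ->
  mono f u p.
Proof.
move=> uv /and3P[pp lp _]; case: p pp lp => [|x p]; first by rewrite /= (negPf uv).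
move=> pp _ mp; apply/existsP.
have [i H] : exists i, all (pred1 i) [seq c [set xy.1; xy.2] | xy <- zip (u :: x :: p) (x :: p)].
  by exists (c [set u; x]); move: mp; rewrite /Defs.mono_path /= eqxx.
exists i; elim: (x :: p) {uv mp} u pp H => //= z q IH w /andP[wz zq] /andP[wz' H].
by rewrite cadj_colouring wz wz' IH.
Qed.

Lemma k_linked_colouring k : mono_k_connected c k -> k_linked f k.
Proof.
move=> link u v uv; have [ps [sps ups /allP H dis]] := link u v uv.
exists ps => //; split=> //; last exact/pairwise_interiorP.
move=> p /H/andP[pp mp]; split; first exact: mono_colouring pp mp.
  by case/and3P: pp => _ /eqP.
by case/and3P: pp.
Qed.

Lemma num_colours_classes : num_colours c = #|[set i | 0 < esize f i]|.
Proof.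
congr #|pred_of_set _|; apply/setP => i; rewrite inE.
apply/imsetP/card_gt0P => [[e /mem_edges[x [y ->]] ->]|[[x y]]].
  by exists (x, y); rewrite inE.
by rewrite inE => /eqP <-; exists (edge x y) => //; apply/mem_edges; exists x, y.
Qed.

Lemma num_colours_excess k : mono_k_connected c k ->
  exists (K : finType) (g : 'I_s -> 'I_t -> K),
  [/\ connected_classes g, k_linked g k &
      num_colours c + \sum_i (esize g i - 1) <= s * t].
Proof.
move=> link; exists _, (refine f); split; first exact: connected_refine.
  exact/k_linked_refine/k_linked_colouring.
rewrite num_colours_classes.
apply: leq_trans (leq_add (num_classes_refine f) (leqnn _)) _.
by rewrite (num_classes _ (card_ord s) (card_ord t)).
Qed.

End Colouring.

(** Connected classes may be assumed, because passing to components loses no colour. *)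
Lemma mc_le k B : (forall (K : finType) (g : 'I_s -> 'I_t -> K),
    connected_classes g -> k_linked g k -> B <= \sum_i (esize g i - 1)) ->
  mc k adj <= s * t - B.
Proof.
move=> bound; apply/bigmax_leqP => c /asboolP/num_colours_excess[K [g [cg lg]]].
by have := bound K g cg lg; lia.
Qed.

Lemma mc_le1 : 0 < s -> mc s adj <= 1.
Proof.
move=> s0; apply/bigmax_leqP => c /asboolP/k_linked_colouring link.
have H := one_class link (card_ord s) s0; rewrite num_colours_classes.
apply/card_le1_eqP => i j; rewrite !inE => /card_gt0P[[x y]] + /card_gt0P[[x' y']].
by rewrite !inE /= => /eqP <- /eqP <-; apply: H.
Qed.

End Bipartite.

(** * Disjoint paths along an injection *)

Section Linkage.
Variables (V : finType) (e : rel V) (u v : V) (phi : V -> V) (W A B : {set V}).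
Hypotheses (uv : u != v) (uW : u \notin W) (vW : v \notin W) (AW : A \subset W).
Hypotheses (eA : forall x, x \in A -> e u x) (eB : forall x, x \in B -> e x v).
Hypothesis step : forall x, x \in W -> x \notin B ->
  [/\ phi x \in W, phi x \notin A & e x (phi x)].
Hypothesis phi_inj : forall x y, x \in W -> y \in W -> x \notin B -> y \notin B ->
  phi x = phi y -> x = y.

Let before i a := forall l, l < i -> iter l phi a \notin B.

Let iter_W i a : a \in A -> before i a -> iter i phi a \in W.
Proof.
move=> aA; elim: i => [_|i IH bi]; first exact: (subsetP AW).
have [||] := @step (iter i phi a) => //; last exact: bi.
by apply: IH => l li; apply: bi; lia.
Qed.

(** Cancel [phi] on both sides until the shorter orbit is at its start. If the other is not, [phi]
    takes a value in [A]. *)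
Let iter_eq i j a a' : a \in A -> a' \in A -> before i a -> before j a' -> i <= j ->
  iter i phi a = iter j phi a' -> i = j /\ a = a'.
Proof.
move=> aA a'A; have pre m b : before m.+1 b -> before m b.
  by move=> H l lm; apply: H; lia.
elim: i j => [|i IH] [|j] bi bj //= ij E.
  have [||_ + _] := @step (iter j phi a'); first exact/iter_W/pre.
    exact: bj.
  by rewrite -E aA.
have [] := IH j (pre _ _ bi) (pre _ _ bj) ij; last by move=> -> ->.
by apply: phi_inj E; rewrite ?bi ?bj ?iter_W //; apply: pre.
Qed.

Let stop a := find [in B] (traject phi a #|V|.+1).

(** An orbit avoiding [B] that long would consist of [#|V| + 1] distinct vertices. *)
Let stop_has a : a \in A -> has [in B] (traject phi a #|V|.+1).
Proof.
move=> aA; apply/negPn/negP => /hasPn noB.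
have bef i : i <= #|V|.+1 -> before i a.
  by move=> iV l li; apply: noB; apply/trajectP; exists l => //; lia.
have ut : uniq (traject phi a #|V|.+1).
  apply/(uniqP a) => i j; rewrite !inE size_traject => iV jV.
  rewrite !nth_traject // => E; have [ij|/ltnW ji] := leqP i j.
    by have [] := iter_eq aA aA (bef _ (ltnW iV)) (bef _ (ltnW jV)) ij E.
  by have [] := iter_eq aA aA (bef _ (ltnW jV)) (bef _ (ltnW iV)) ji (esym E).
by have := max_card (mem (traject phi a #|V|.+1)); rewrite (card_uniqP ut) size_traject ltnn.
Qed.

Let stopP a : a \in A -> before (stop a) a /\ iter (stop a) phi a \in B.
Proof.
move=> aA; have hB := stop_has aA.
have lt : stop a < #|V|.+1 by have := hB; rewrite has_find size_traject.
split=> [l ll|]; last by have := nth_find a hB; rewrite nth_traject.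
by have := before_find a ll; rewrite nth_traject ?(ltn_trans ll) // => /negbT.
Qed.

Let walk a := rcons (traject phi a (stop a).+1) v.

Let walkP a x : reflect (x = v \/ exists2 i, i <= stop a & x = iter i phi a) (x \in walk a).
Proof.
rewrite mem_rcons inE; apply: (iffP predU1P) => [[->|/trajectP[i]]|[->|[i il ->]]]; try by left.
  by right; exists i.
by right; apply/trajectP; exists i.
Qed.

Let walk_W a i : a \in A -> i <= stop a -> before i a /\ iter i phi a \in W.
Proof.
move=> aA ia; have [sb _] := stopP aA.
have bi : before i a by move=> l li; apply: sb; lia.
by split=> //; apply: iter_W.
Qed.

Let walk_disjoint a a' x : a \in A -> a' \in A -> x \in walk a -> x \in walk a' ->
  x = v \/ a = a'.
Proof.
move=> aA a'A /walkP[->|[i ia ->]]; first by left.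
have [bi Wi] := walk_W aA ia; case/walkP=> [->|[j ja E]]; first by left.
have [bj Wj] := walk_W a'A ja; right; have [ij|/ltnW ji] := leqP i j.
  by have [] := iter_eq aA a'A bi bj ij E.
by have [] := iter_eq a'A aA bj bi ji (esym E).
Qed.

Let walk_path a : a \in A -> path e u (walk a).
Proof.
move=> aA; have [_ sB] := stopP aA.
rewrite /walk rcons_path /= eA //= last_traject eB ?andbT //.
apply/(pathP a) => i; rewrite size_traject => ia.
have -> : nth a (a :: traject phi (phi a) (stop a)) i = iter i phi a.
  by rewrite -[_ :: _]/(traject phi a (stop a).+1) nth_traject //; lia.
rewrite (set_nth_default (phi a)) ?size_traject // nth_traject // -iterSr iterS.
have [_ iW] := walk_W aA (ltnW ia); have [sb _] := stopP aA.
by have [] := step iW (sb _ ia).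
Qed.

Let walk_uniq a : a \in A -> uniq (u :: walk a).
Proof.
move=> aA; rewrite cons_uniq rcons_uniq; apply/and3P; split.
- apply/walkP => -[/eqP|[i ia ui]]; first by rewrite (negPf uv).
  by have [_] := walk_W aA ia; rewrite -ui (negPf uW).
- apply/trajectP => -[i ia vi].
  by have [|_] := @walk_W a i aA; rewrite -?vi ?(negPf vW).
apply/(uniqP a) => i j; rewrite !inE size_traject !ltnS => ia ja.
rewrite !nth_traject // => E.
have [[bi _] [bj _]] := (walk_W aA ia, walk_W aA ja).
have [ij|/ltnW ji] := leqP i j; first by have [] := iter_eq aA aA bi bj ij E.
by have [] := iter_eq aA aA bj bi ji (esym E).
Qed.

Let walk_inj : {in A &, injective walk}.
Proof. by move=> a a' _ _ /(congr1 (head v)). Qed.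

(* Following [phi] from each point of [A] until [B] is reached gives disjoint
   paths: [phi] is injective and never enters [A], so two orbits cannot merge. *)
Lemma linkage :
  exists ps, [/\ size ps = #|A|, path_system (path e) u v ps & [:: v] \notin ps].
Proof.
exists [seq walk a | a <- enum A]; split; first by rewrite size_map -cardE.
  split.
  - rewrite map_inj_in_uniq ?enum_uniq // => a a'; rewrite !mem_enum; exact: walk_inj.
  - move=> _ /mapP[a + ->]; rewrite mem_enum => aA; split.
    + exact: walk_path.
    + by rewrite last_rcons.
    + exact: walk_uniq.
  move=> _ _ /mapP[a + ->] /mapP[a' + ->]; rewrite !mem_enum => aA a'A ne x xa xa'.
  by case: (walk_disjoint aA a'A xa xa') => // aa'; rewrite aa' eqxx in ne.
by apply/mapP => -[a _] /(congr1 size); rewrite size_rcons size_traject.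
Qed.

End Linkage.

(** The single edge has no interior, so it only needs to be new. It supplies the last path when [u]
    and [v] are adjacent. *)
Lemma path_system_edge (V : finType) (e : rel V) (u v : V) ps : u != v -> e u v ->
  path_system (path e) u v ps -> [:: v] \notin ps ->
  path_system (path e) u v ([:: v] :: ps).
Proof.
move=> uv euv [ups H dis] vps; split; first by rewrite /= vps.
  by move=> p; rewrite inE => /predU1P[->|/H//]; rewrite /= euv inE uv.
move=> p q; rewrite !inE => /predU1P[->|pps] /predU1P[->|qps] pq x.
- by rewrite eqxx in pq.
- by rewrite inE => /eqP.
- by move=> _; rewrite inE => /eqP.
- exact: dis.
Qed.

Lemma path_system_map (V V' : finType) (e : rel V) (e' : rel V') (h : V -> V')
    (u v : V) ps : injective h -> {homo h : x y / e x y >-> e' x y} ->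
  path_system (path e) u v ps -> path_system (path e') (h u) (h v) (map (map h) ps).
Proof.
move=> hinj he [ups H dis]; split.
- by rewrite map_inj_uniq //; apply: inj_map.
- move=> _ /mapP[p /H[pp lp up] ->]; split.
  + by apply: homo_path pp.
  + by rewrite last_map lp.
  + by rewrite -map_cons map_inj_uniq.
move=> _ _ /mapP[p pps ->] /mapP[q qps ->] ne _ /mapP[x xp ->].
rewrite mem_map // => xq; congr h; apply: (dis p q) => //.
by apply: contraNneq ne => ->.
Qed.

(** * Circulant bipartite graphs *)

Definition rel_linked (V : finType) (e : rel V) (k : nat) (u v : V) :=
  exists2 ps, size ps = k & path_system (path e) u v ps.

Lemma rel_linked_map (V V' : finType) (e : rel V) (e' : rel V') (h : V -> V') k u v :
  injective h -> {homo h : x y / e x y >-> e' x y} ->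
  rel_linked e k u v -> rel_linked e' k (h u) (h v).
Proof.
move=> hinj he [ps sps sys]; exists (map (map h) ps); first by rewrite size_map.
exact: path_system_map sys.
Qed.

Section Circulant.
Variables m k : nat.
Local Notation s := m.+1.
Local Notation V := ('I_s + 'I_s)%type.
Hypotheses (k_ge2 : 1 < k) (k_le_s : k <= s).

(** Cyclic distance unfolded over natural numbers, so that [lia] can check the matchings. *)
Definition near (x j : nat) := (j <= x) && (x - j < k) || (x < j) && (x + s - j < k).

Lemma nearE (x j : 'I_s) : ((x - j)%R < k) = near x j.
Proof.
have -> : nat_of_ord (x - j)%R = (x + (s - j) %% s) %% s by [].
rewrite modnDmr /near; have := ltn_ord x; have := ltn_ord j => js xs.
have [jx|jx] /= := leqP j x.
  have -> : x + (s - j) = (x - j) + s by lia.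
  by rewrite modnDr modn_small ?orbF //; lia.
by rewrite modn_small; last lia; congr (_ < _); lia.
Qed.

Definition circ : rel V := fun u v =>
  match u, v with
  | inl x, inr j | inr j, inl x => (x - j)%R < k
  | _, _ => false
  end.

Lemma circE (x j : 'I_s) :
  (circ (inl x) (inr j) = near x j) * (circ (inr j) (inl x) = near x j).
Proof. by split; apply: nearE. Qed.

Section NatLinkage.
Variables (v : V) (WS WT AS BS BT : pred nat) (pS pT : nat -> nat).
Hypothesis (v0 : inr ord0 != v) (WT0 : ~~ WT 0).
Hypothesis vW : match v with inl x => ~~ WS x | inr j => ~~ WT j end.
Hypothesis ASP : forall y : 'I_s, AS y -> WS y && (y < k).
Hypothesis BSP : forall y : 'I_s, BS y -> circ (inl y) v.
Hypothesis BTP : forall j : 'I_s, BT j -> circ (inr j) v.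
Hypothesis pSP : forall y, y < s -> WS y -> ~~ BS y ->
  [&& pS y < s, WT (pS y) & near y (pS y)].
Hypothesis pTP : forall j, j < s -> WT j -> ~~ BT j ->
  [&& pT j < s, WS (pT j), ~~ AS (pT j) & near (pT j) j].
Hypothesis pS_inj : forall y y', y < s -> y' < s -> WS y -> WS y' ->
  ~~ BS y -> ~~ BS y' -> pS y = pS y' -> y = y'.
Hypothesis pT_inj : forall j j', j < s -> j' < s -> WT j -> WT j' ->
  ~~ BT j -> ~~ BT j' -> pT j = pT j' -> j = j'.

(** The instance of [linkage] with source [inr ord0], where [phi] is split into [pS] from [S] to [T]
    and [pT] back. Everything is stated on natural numbers to leave only arithmetic goals. *)
Lemma nat_linkage : exists ps,
  [/\ size ps = #|[set y : 'I_s | AS y]|,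
      path_system (path circ) (inr ord0) v ps & [:: v] \notin ps].
Proof.
pose W : {set V} := [set u : V | match u with inl x => WS x | inr j => WT j end].
pose A : {set V} := [set inl y | y in [set y : 'I_s | AS y]].
pose B : {set V} := [set u : V | match u with inl x => BS x | inr j => BT j end].
pose phi (u : V) : V := match u with
  | inl y => inr (inord (pS y)) | inr j => inl (inord (pT j)) end.
have inlA y : (inl y \in A) = AS y.
  by rewrite mem_imset ?inE // => ? ? [].
have inrA j : (inr j \in A) = false by apply/imsetP => -[].
have -> : #|[set y : 'I_s | AS y]| = #|A| by rewrite card_imset // => ? ? [].
apply: (@linkage _ circ (inr ord0) v phi W A B) => //.
- by rewrite inE.
- by rewrite inE; case: (v) vW.
- by apply/subsetP=> -[y|j]; rewrite ?inrA // inlA inE => /ASP/andP[].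
- by case=> [y|j]; rewrite ?inrA // inlA circE /near /= => /ASP/andP[_]; lia.
- by case=> [y|j]; rewrite inE; [apply: BSP | apply: BTP].
- case=> [y|j]; rewrite !inE => wy by_; rewrite /phi ?inlA ?inrA circE.
    by have /and3P[ps ? ?] := pSP (ltn_ord y) wy by_; rewrite inordK.
  by have /and4P[ps ? ? ?] := pTP (ltn_ord j) wy by_; rewrite inordK.
case=> [y|j] [y'|j'] //; rewrite !inE => w w' b b' [].
  have /and3P[ps _ _] := pSP (ltn_ord y) w b.
  have /and3P[ps' _ _] := pSP (ltn_ord y') w' b'.
  move/(congr1 val); rewrite /= !inordK // => /pS_inj E; congr inl.
  by apply: ord_inj; apply: E.
have /and4P[ps _ _ _] := pTP (ltn_ord j) w b.
have /and4P[ps' _ _ _] := pTP (ltn_ord j') w' b'.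
move/(congr1 val); rewrite /= !inordK // => /pT_inj E; congr inr.
by apply: ord_inj; apply: E.
Qed.

End NatLinkage.

Lemma card_lt_k : #|[set y : 'I_s | y < k]| = k.
Proof. by rewrite -sum1dep_card -(big_ord_widen s (fun=> 1)) // sum1_card card_ord. Qed.

(* In the next four lemmas [pT] and the inverse of [pS] are matchings from T to S, chosen
   monotone for the cyclic order; this keeps matched indices within distance [k]. *)
Lemma linked_TT_near (b : 'I_s) : 0 < b < k -> rel_linked circ k (inr ord0) (inr b).
Proof.
case/andP=> b0 bk; have bs := ltn_ord b.
(* Each round trip lowers the index in [S] by [b] modulo [s], until a neighbour of [b] is
   reached. *)
have [||||||||||ps [sps sys _]] := @nat_linkage (inr b) predT (leq k) (fun y => y < k)
  (fun y => near y b) pred0 (fun y => if b <= y then y - b else y + s - b) id.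
- by apply/eqP => -[/(congr1 val)] /=; lia.
- by lia.
- by lia.
- by [].
- by move=> y; rewrite circE.
- by [].
- by move=> y ys _ /=; rewrite /near; case: ifP; lia.
- by move=> j js /=; rewrite /near; lia.
- by move=> y y' ys ys' _ _ /=; rewrite /near; case: ifP; case: ifP; lia.
- by [].
by exists ps => //; rewrite sps card_lt_k.
Qed.

Lemma linked_TT_far (b : 'I_s) : k <= b -> rel_linked circ k (inr ord0) (inr b).
Proof.
move=> bk; have bs := ltn_ord b.
(* The walk from [k - 1] climbs by 1 up to [b]. The others, unless already adjacent to [b], wrap
   round to the top and descend by [k - 1]. *)
have [||||||||||ps [sps sys _]] := @nat_linkage (inr b) predT
  (fun j => (k - 1 <= j < b) || (b < j)) (fun y => y < k) (fun y => near y b) pred0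
  (fun y => if k - 1 <= y < b then y else if k - 1 <= y then y - (k - 1) else y + s - (k - 1))
  (fun j => if j < b then j.+1 else j).
- by apply/eqP => -[/(congr1 val)] /=; lia.
- by lia.
- by lia.
- by [].
- by move=> y; rewrite circE.
- by [].
- by move=> y ys _ /=; rewrite /near; case: ifP; last case: ifP; lia.
- by move=> j js /=; rewrite /near; case: ifP; lia.
- by move=> y y' ys ys' _ _ /=; rewrite /near; do 2! (case: ifP; last case: ifP); lia.
- by move=> j j' js js' /=; case: ifP; case: ifP; lia.
by exists ps => //; rewrite sps card_lt_k.
Qed.

(** A bijection from [S] without [x] to [T] without 0 that moves each index by at most 1
    cyclically. *)
Let pS (x y : nat) := if y == 0 then s - 1 else if (y < x) || (x == 0) then y else y - 1.

Lemma linked_TS_far (x : 'I_s) : k <= x -> rel_linked circ k (inr ord0) (inl x).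
Proof.
move=> xk; have xs := ltn_ord x.
have [||||||||||ps [sps sys _]] := @nat_linkage (inl x) (fun y => y != x)
  (fun j => j != 0) (fun y => y < k) pred0 (near x) (pS x)
  (fun j => if j <= x - k then j + k - 1 else j).
- by [].
- by [].
- by rewrite eqxx.
- by move=> y /=; lia.
- by [].
- by move=> j; rewrite circE.
- by move=> y ys /=; rewrite /pS /near; case: ifP; last case: ifP; lia.
- by move=> j js /=; rewrite /near; case: ifP; lia.
- by move=> y y' ys ys' /=; rewrite /pS; do 2! (case: ifP; last case: ifP); lia.
- by move=> j j' js js' /=; rewrite /near; case: ifP; case: ifP; lia.
by exists ps => //; rewrite sps card_lt_k.
Qed.

Lemma linked_TS_near (x : 'I_s) : x < k -> rel_linked circ k (inr ord0) (inl x).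
Proof.
move=> xk; have xs := ltn_ord x.
(* Here [x] is adjacent to the source, so the walks start at the other [k - 1] neighbours and the
   edge itself is added afterwards. *)
have [||||||||||ps [sps sys vps]] := @nat_linkage (inl x) (fun y => y != x)
  (fun j => j != 0) (fun y => (y < k) && (y != x)) pred0 (near x) (pS x)
  (fun j => j + (k - 1) - x).
- by [].
- by [].
- by rewrite eqxx.
- by move=> y /=; lia.
- by [].
- by move=> j; rewrite circE.
- by move=> y ys /=; rewrite /pS /near; case: ifP; last case: ifP; lia.
- by move=> j js /=; rewrite /near; lia.
- by move=> y y' ys ys' /=; rewrite /pS; do 2! (case: ifP; last case: ifP); lia.
- by move=> j j' js js' /=; rewrite /near; lia.
exists ([:: inl x] :: ps); last by apply: path_system_edge; rewrite // circE /near /=; lia.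
rewrite /= sps -[RHS]card_lt_k (cardsD1 x [set y : 'I_s | y < k]) inE xk.
by congr _.+1; apply: eq_card => y; rewrite !inE andbC.
Qed.

(** The graph is vertex-transitive: translations act on each side, and negation exchanges the sides.
    So the source may be [inr ord0]. *)
Lemma circ_linked u v : u != v -> rel_linked circ k u v.
Proof.
have base w : inr ord0 != w -> rel_linked circ k (inr ord0) w.
  case: w => [x|b] w0.
    by have [xk|xk] := ltnP x k; [apply: linked_TS_near | apply: linked_TS_far].
  have [bk|bk] := ltnP b k; last exact: linked_TT_far.
  apply: linked_TT_near; rewrite bk andbT lt0n; apply: contraNneq w0 => b0.
  by apply/eqP; congr inr; apply: val_inj.
pose shift (a : 'I_s) (w : V) : V := match w with inl x => inl (x + a)%R | inr j => inr (j + a)%R end.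
have shift_inj a : injective (shift a).
  by apply: (can_inj (g := shift (- a)%R)) => -[x|j]; rewrite /shift addrK.
have shift_homo a : {homo shift a : w w' / circ w w'}.
  by case=> [x|j] [x'|j'] //; rewrite /circ /shift opprD addrACA subrr addr0.
have shiftK a w : shift a (shift (- a)%R w) = w by case: w => z; rewrite /shift subrK.
have fromT a w : inr a != w -> rel_linked circ k (inr a) w.
  have aE : inr a = shift a (inr ord0) by exact: (congr1 inr (esym (add0r a))).
  move=> aw; rewrite -(shiftK a w) aE; apply: rel_linked_map => //; apply: base.
  by apply: contraNneq aw => E; rewrite -(shiftK a w) -E -aE.
pose swap (w : V) : V := match w with inl x => inr (- x)%R | inr j => inl (- j)%R end.
have swapK : involutive swap by case=> x; rewrite /swap opprK.
have swap_homo : {homo swap : w w' / circ w w'}.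
  by case=> [x|j] [x'|j'] //; rewrite /circ /swap opprK addrC.
case: u => [x|j] uv; last exact: fromT.
rewrite -(swapK (inl x)) -(swapK v).
apply: (rel_linked_map (e := circ) (h := swap)) => //; first exact: can_inj swapK.
by apply: (fromT (- x)%R); rewrite (can_eq swapK (inl x) v).
Qed.

(** * From equal sides to a larger second class *)

Section Extension.
Variable t : nat.
Hypothesis s_le_t : s <= t.
Local Notation V' := ('I_s + 'I_t)%type.

Definition residue (y : 'I_t) : 'I_s := inord (y %% s).

Definition ecirc : rel V' := fun u v =>
  match u, v with
  | inl x, inr y | inr y, inl x => (x - residue y)%R < k
  | _, _ => false
  end.

Lemma card_neighbours (j : 'I_s) : #|[set x : 'I_s | (x - j)%R < k]| = k.
Proof.
have -> : [set x : 'I_s | (x - j)%R < k] = [set (y + j)%R | y : 'I_s in [set y : 'I_s | y < k]].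
  apply/setP => x; rewrite inE; apply/idP/imsetP => [xj|[y + ->]].
    by exists (x - j)%R; rewrite ?inE // subrK.
  by rewrite inE addrK.
by rewrite card_imset ?card_lt_k //; apply: addIr.
Qed.

Lemma ecirc_section (g : 'I_s -> 'I_t) u v : cancel g residue -> u != v ->
  let h (w : V) : V' := match w with inl x => inl x | inr j => inr (g j) end in
  rel_linked ecirc k (h u) (h v).
Proof.
move=> gK uv; apply: rel_linked_map (circ_linked uv).
  by case=> [x|j] [x'|j'] //= [] => [->|/(can_inj gK) ->].
by case=> [x|j] [x'|j'] //=; rewrite gK.
Qed.

Let base (j : 'I_s) : 'I_t := widen_ord s_le_t j.

Let baseK : cancel base residue.
Proof. by move=> j; apply: val_inj; rewrite /residue /= inordK modn_small. Qed.

(** A section of [residue] through the given vertices of [T] embeds the circulant graph. Two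
    vertices with equal residues lie on no common section, but have [k] common neighbours. *)
Lemma ecirc_linked u v : u != v -> rel_linked ecirc k u v.
Proof.
pose g y y' (j : 'I_s) := if j == residue y then y else if j == residue y' then y' else base j.
have gK y y' : cancel (g y y') residue.
  by move=> j; rewrite /g; case: eqP => // _; case: eqP.
have g1 y y' : g y y' (residue y) = y by rewrite /g eqxx.
case: u v => [x|y] [x'|y'] uv.
- exact: (@ecirc_section base (inl x) (inl x') baseK).
- by have := @ecirc_section (g y' y') (inl x) (inr (residue y')) (gK _ _) isT; rewrite /= g1.
- by have := @ecirc_section (g y y) (inr (residue y)) (inl x') (gK _ _) isT; rewrite /= g1.
have [res|res] := eqVneq (residue y) (residue y').
  pose N := [set x : 'I_s | (x - residue y)%R < k].
  exists [seq [:: inl x; inr y'] | x <- enum N]; first by rewrite size_map -cardE card_neighbours.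
  split.
  - by rewrite map_inj_uniq ?enum_uniq // => ? ? [].
  - move=> _ /mapP[x + ->]; rewrite mem_enum inE => xN; split=> //.
      by rewrite /= xN -res xN.
    by rewrite /= !inE (negPf uv).
  move=> _ _ /mapP[x _ ->] /mapP[x' _ ->] ne z; rewrite !inE.
  by move=> /orP[]/eqP-> // /orP[]/eqP // [] xx'; rewrite xx' eqxx in ne.
have g2 : g y y' (residue y') = y' by rewrite /g eq_sym (negPf res) eqxx.
have := @ecirc_section (g y y') (inr (residue y)) (inr (residue y')) (gK _ _) res.
by rewrite /= g1 g2.
Qed.

Lemma mc_ge : s * t - k * t + 1 <= mc k (@Kbip_adj s t).
Proof.
pose F : {set {set V'}} :=
  [set edge z.1 z.2 | z in [set z : 'I_s * 'I_t | (z.1 - residue z.2)%R < k]].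
have cardF : #|F| <= k * t.
  apply: leq_trans (leq_imset_card _ _) _.
  rewrite -sum1dep_card.
  rewrite -(pair_big_dep xpredT (fun (x : 'I_s) y => (x - residue y)%R < k) (fun _ _ => 1)) /=.
  rewrite (exchange_big_dep xpredT) //= (eq_bigr (fun=> k)).
    by rewrite sum_nat_const card_ord mulnC.
  by move=> y _; rewrite sum1dep_card card_neighbours.
have y0 : 'I_t by exists 0; lia.
pose e0 := edge (residue y0) y0.
have e0E : e0 \in edges (@Kbip_adj s t) by apply/mem_edges; exists (residue y0), y0.
have e0F : e0 \in F.
  by apply/imsetP; exists (residue y0, y0); rewrite ?inE // subrr; apply: ltnW.
pose rk := enum_rank_in e0E.
(* Ranks serve as colours: [F] takes the rank of its member [e0], every other edge its own. *)
pose c : colouring (@Kbip_adj s t) := [ffun e => if e \in F then rk e0 else rk e].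
have colF u v : ecirc u v -> c [set u; v] = rk e0.
  move=> uv; rewrite ffunE ifT //; apply/imsetP.
  case: u v uv => [x|y] [x'|y'] //= uv; first by exists (x, y'); rewrite ?inE.
  by exists (x', y); rewrite ?inE //= /edge setUC.
have conn : mono_k_connected c k.
  move=> u v uv; have [ps sps [ups H dis]] := ecirc_linked uv.
  exists ps; split=> //; last exact/pairwise_interiorP.
  apply/allP => p /H[pp lp up]; rewrite /is_path lp eqxx up /= !andbT.
  apply/andP; split; first by apply: sub_path pp => -[x|y] [x'|y'].
  apply: (@all_pred1_constant _ (rk e0)).
  elim: p u pp {sps ups H dis uv lp up} => //= w p IH u /andP[uw wp].
  by rewrite colF // eqxx IH.
apply: leq_trans (leq_bigmax_cond c (asboolT conn)).
have sub : rk @: (e0 |: (edges (@Kbip_adj s t) :\: F)) \subset c @: edges (@Kbip_adj s t).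
  apply/subsetP => _ /imsetP[e + ->]; rewrite in_setU1 in_setD.
  case/orP=> [/eqP ->|].
    by apply/imsetP; exists e0; rewrite // ffunE e0F.
  by case/andP=> eF eE; apply/imsetP; exists e; rewrite // ffunE (negPf eF).
rewrite /num_colours; apply: leq_trans (subset_leq_card sub).
rewrite card_in_imset.
  rewrite cardsU1 in_setD e0F /= addnC leq_add2l cardsD card_edges.
  by apply: leq_sub2l; apply: leq_trans (subset_leq_card (subsetIr _ _)) cardF.
have inE' e : e \in e0 |: edges (@Kbip_adj s t) :\: F -> e \in edges (@Kbip_adj s t).
  by rewrite in_setU1 in_setD => /orP[/eqP->|/andP[]].
by move=> e e' /inE' eE /inE' eE'; apply: enum_rank_in_inj.
Qed.

End Extension.
End Circulant.

(** * Assembling the bounds *)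

Theorem theorem4p4 :
  (forall s t k : nat, 2 <= k -> k <= s -> s <= t ->
     [/\ s * t - k * t + 1 <= mc k (@Kbip_adj s t),
         mc k (@Kbip_adj s t) <= s * t - (k * t).+1 %/ 2 + 1 &
         (s = k \/ k = 2 \/ k = 3) -> mc k (@Kbip_adj s t) = s * t - k * t + 1])
  /\
  (forall t k : nat, 2 <= k -> k <= t ->
     [/\ t * t - k * t + 1 <= mc k (@Kbip_adj t t),
         mc k (@Kbip_adj t t) <= t * t - ((2 * k - 1) * t).+1 %/ 2 + 1 &
         (k \in [:: 2; 3; 4; 5]) -> mc k (@Kbip_adj t t) = t * t - k * t + 1]).
Proof.
have lower s t k : 2 <= k -> k <= s -> s <= t ->
    s * t - k * t + 1 <= mc k (@Kbip_adj s t).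
  by case: s => [|m] k2 ks st; [lia | apply: mc_ge].
have exact s t k : 2 <= k -> k <= s -> s <= t -> k * t <= s * t ->
    mc k (@Kbip_adj s t) <= s * t - (k * t - 1) ->
    mc k (@Kbip_adj s t) = s * t - k * t + 1.
  move=> k2 ks st kst ub; apply/eqP; rewrite eqn_leq lower // andbT.
  have := leq_mul k2 (leq_trans ks st); lia.
have exact_a s t k : 2 <= k -> k <= s -> s <= t -> (s = k \/ k = 2 \/ k = 3) ->
    mc k (@Kbip_adj s t) = s * t - k * t + 1.
  move=> k2 ks st sk; apply: exact => //; first by rewrite leq_mul2r ks orbT.
  have [sk'|nsk] := eqVneq s k.
    by rewrite -sk'; apply: leq_trans (mc_le1 _ _) _; nia.
  apply: mc_le => K g cg lg.
  have := excess_k23 cg lg k2 (card_ord s) (card_ord t) ks st; lia.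
split=> [s t k k2 ks st|t k k2 kt]; split.
- exact: lower.
- apply: (@leq_trans (s * t - ((k * t).+1 %/ 2 - 1))); last by lia.
  apply: mc_le => K g cg lg.
  have := excess_ge lg k2 (card_ord s) (card_ord t) ks st; nia.
- exact: exact_a.
- exact: lower.
(* Here [m.+1 %/ 2] is the ceiling of [m / 2]. *)
- apply: (@leq_trans (t * t - (((2 * k - 1) * t).+1 %/ 2 - 1))); last by lia.
  apply: mc_le => K g cg lg.
  have := excess_square cg lg k2 (card_ord t) (card_ord t) kt (leqnn t) (erefl t); lia.
move=> k5; have [k3|k3] := leqP k 3; first by apply: exact_a => //; lia.
(* [excess_k45] needs [k < t]; the case [t = k] is the single-colour case of the first part. *)
have [tk|ntk] := eqVneq t k; first by apply: exact_a => //; left.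
apply: exact => //; first by rewrite leq_mul2r kt orbT.
apply: mc_le => K g cg lg.
have := excess_k45 cg lg k2 (card_ord t) (card_ord t) kt (leqnn t) (erefl t).
have -> : 3 < k <= 5 by move: k5; rewrite !inE; lia.
by move=> /(_ isT); lia.
Qed.
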